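(* There exist two normal infinite words $x$ and $y$ such that $x\vee y$ is normal but $x$ and $y$ are not finite-state independent.
   Context: For $x=a_1a_2\cdots$, $y=b_1b_2\cdots$, $x\vee y=a_1b_1a_2b_2\cdots$. Normality: for all $\ell$ and $u\in A^\ell$, the frequency of aligned occurrences (occurrences at positions $i\equiv1\bmod\ell$) of $u$ in prefixes of $x$, normalized by $n/\ell$, tends to $|A|^{-\ell}$. A $k$-automaton $\langle Q,A,\delta,I\rangle$ has finite state set $Q$, transitions $\delta\subseteq Q\times(A\cup\{\varepsilon\})^k\times Q$, initial states $I$; an infinite run is accepting if it starts in $I$ and all label components are infinite. It is $\ell$-deterministic if $I$ is a singleton and for two transitions from the same state, $\alpha_j=\varepsilon$ for some $j\le\ell$ forces $\alpha'_j=\varepsilon$, and agreement on the first $\ell$ label components forces agreement of the remaining components and targets. $\rho(x)$ is the infimum over injective $1$-deterministic $2$-automata $\mathcal T$ of $\liminf_n |v_1\cdots v_n|/n$, where $q_0\xrightarrow{a_1|v_1}q_1\xrightarrow{a_2|v_2}\cdots$ is the run on $x$. A compressor is a $2$-deterministic $3$-automaton with input $x$, oracle $y$, output, injective in $x$ for fixed $y$; $\rho_{\mathcal C}(x/y)=\liminf_n|w_1\cdots w_n|/|\alpha_1\cdots\alpha_n|$ for the run $q_0\xrightarrow{\alpha_1,\beta_1|w_1}\cdots$, and $\rho(x/y)$ is the infimum over compressors. $x,y$ are finite-state independent if $\rho(x/y)=\rho(x)$, $\rho(y/x)=\rho(y)$ and $\rho(x),\rho(y)\neq0$. *)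

(* Defs.v *)
From HB Require Import structures.
From mathcomp Require Import all_boot all_order all_algebra.
From mathcomp Require Import all_classical all_reals.
From mathcomp Require Import ereal topology normedtype sequences.
From mathcomp Require Import Rstruct Rstruct_topology.

Set Implicit Arguments.
Unset Strict Implicit.
Unset Printing Implicit Defensive.

Import Order.TTheory GRing.Theory Num.Theory.
Local Open Scope classical_set_scope.
Local Open Scope ring_scope.
Local Open Scope ereal_scope.
Local Open Scope ring_scope.

Notation RR := Rdefinitions.R.

Section Words.
Variable A : finType.

(* Infinite words a_1 a_2 ... , indexed from 0. *)
Definition word := nat -> A.

Definition join (x y : word) : word :=
  fun n => if odd n then y n./2 else x n./2.

Definition aligned_occ (x : word) (l : nat) (u : seq A) (n : nat) : nat :=
  count (fun j => mkseq (fun i => x (j * l + i)) l == u) (iota 0 (n %/ l)).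

Definition normal (x : word) : Prop :=
  forall (l : nat), (0 < l)%N -> forall u : seq A, size u = l ->
    (fun n : nat => ((aligned_occ x l u n)%:R / (n%:R / l%:R) : RR))
      @ \oo --> ((#|A|%:R) ^- l : RR).

(* k-automata: finite state set, transitions labelled by k-tuples over A ∪ {ε}
   (ε = None), set of initial states. *)
Record automaton (k : nat) := Automaton {
  state : finType;
  trans : state -> k.-tuple (option A) -> state -> bool;
  init  : pred state }.

Definition cnt (k : nat) (l : nat -> k.-tuple (option A)) (j : 'I_k) (t : nat) : nat :=
  count (fun i => tnth (l i) j != None) (iota 0 t).

Definition accepting (k : nat) (M : automaton k) (q : nat -> @state k M)
  (l : nat -> k.-tuple (option A)) : Prop :=
  q 0%N \in @init k M /\
  (forall n, @trans k M (q n) (l n) (q n.+1)) /\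
  (forall (j : 'I_k) (N : nat), exists n, (N <= n)%N /\ tnth (l n) j != None).
Arguments accepting {k} M q l.

Definition spells (k : nat) (l : nat -> k.-tuple (option A)) (j : 'I_k) (w : word) : Prop :=
  forall t a, tnth (l t) j = Some a -> w (cnt l j t) = a.

(* l-deterministic (indices j <= l in the paper, i.e. j < l 0-based) *)
Definition deterministic (k : nat) (ld : nat) (M : automaton k) : Prop :=
  (exists q0, forall q, (q \in @init k M) = (q == q0)) /\
  forall (p q q' : @state k M) (al al' : k.-tuple (option A)),
    @trans k M p al q -> @trans k M p al' q' ->
    (forall j : 'I_k, (j < ld)%N -> tnth al j = None -> tnth al' j = None) /\
    ((forall j : 'I_k, (j < ld)%N -> tnth al j = tnth al' j) -> al = al' /\ q = q').

Definition i0 : 'I_2 := @Ordinal 2 0 isT.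
Definition i1 : 'I_2 := @Ordinal 2 1 isT.
Definition c0 : 'I_3 := @Ordinal 3 0 isT.
Definition c1 : 'I_3 := @Ordinal 3 1 isT.
Definition c2 : 'I_3 := @Ordinal 3 2 isT.

(* 2-automaton (input, output) realizing an injective relation *)
Definition injective_transducer (T : automaton 2) : Prop :=
  forall q l q' l' (x x' z : word),
    accepting T q l -> accepting T q' l' ->
    spells l i0 x -> spells l' i0 x' -> spells l i1 z -> spells l' i1 z ->
    x = x'.

(* Values liminf_n |v_1...v_n|/n for the run of T on x; t n is the index of
   the transition reading a_{n+1}, so the transitions before it output
   v_1 ... v_n. *)
Definition transducer_ratio (T : automaton 2) (x : word) : set (\bar RR) :=
  [set v | exists q l (t : nat -> nat),
     [/\ accepting T q l, spells l i0 x,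
         (forall n, cnt l i0 (t n) = n /\ tnth (l (t n)) i0 != None) &
         v = limn_einf (fun n : nat =>
               (((cnt l i1 (t n.+1))%:R / (n.+1)%:R : RR))%:E)]].

Definition rho (x : word) : \bar RR :=
  ereal_inf [set v | exists T : automaton 2,
    [/\ deterministic 1 T, injective_transducer T & transducer_ratio T x v]].

(* compressor: 2-deterministic 3-automaton (input, oracle, output),
   injective in the input for a fixed oracle *)
Definition compressor (C : automaton 3) : Prop :=
  deterministic 2 C /\
  forall q l q' l' (x x' y z : word),
    accepting C q l -> accepting C q' l' ->
    spells l c0 x -> spells l' c0 x' ->
    spells l c1 y -> spells l' c1 y ->
    spells l c2 z -> spells l' c2 z -> x = x'.

Definition compressor_ratio (C : automaton 3) (x y : word) : set (\bar RR) :=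
  [set v | exists q l,
     [/\ accepting C q l, spells l c0 x, spells l c1 y &
         v = limn_einf (fun n : nat =>
               (((cnt l c2 n.+1)%:R / (cnt l c0 n.+1)%:R : RR))%:E)]].

Definition rho_cond (x y : word) : \bar RR :=
  ereal_inf [set v | exists C : automaton 3,
    compressor C /\ compressor_ratio C x y v].

Definition fs_independent (x y : word) : Prop :=
  [/\ rho_cond x y = rho x, rho_cond y x = rho y, rho x <> 0%E & rho y <> 0%E].

End Words.

(* Main.v *)
(* Take y = (x_{2n+1})_n, the subword of x at odd (0-based) positions.  A compressor reading x
   as oracle at double speed can check that its input is y, so it only needs to output one
   letter now and then, and rho(y/x) = 0.  Hence either rho(y) <> rho(y/x) or rho(y) = 0.

   It remains to find x such that x, y and their join are normal.  The letters of x are chosen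
   greedily.  Countably many tests each predict, from the prefix read so far, that the next
   letter is a given a; the excess S_i(n) of test i is the number of its successes minus 1/|A|
   times the number of its predictions.  A uniformly random letter increases the mean of S_i^2
   by at most 1, so some letter increases the potential sum_i 4^-i S_i^2 by O(1), and then
   S_i(n) = O(sqrt n) for every i.  Any block of the join, from the second on, consists of
   letters of x at distinct positions; listing these increasingly and using the tests that
   predict each letter after the previous ones gives the frequency of the block. *)
Require Import Defs.
From mathcomp Require Import all_boot all_order all_algebra.
From mathcomp Require Import all_classical all_reals.
From mathcomp Require Import ereal topology normedtype sequences.
From mathcomp Require Import Rstruct Rstruct_topology.
From mathcomp Require Import zify ring lra.

Set Implicit Arguments.
Unset Strict Implicit.
Unset Printing Implicit Defensive.

Import Order.TTheory GRing.Theory Num.Theory.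
Import numFieldNormedType.Exports.
Local Open Scope ring_scope.

(** * Greedy choice of letters keeping countably many excesses sublinear *)

Section BalancedWord.
Variables (R : realType) (A : finType) (a0 : A).
Variable phi : nat -> seq A -> A -> R.
Hypothesis phi_mean0 : forall i h, \sum_a phi i h a = 0.
Hypothesis phi_le1 : forall i h a, `|phi i h a| <= 1.

Let excess (i : nat) (h : seq A) : R :=
  \sum_(m < size h) phi i (take m h) (nth a0 h m).

Let excess_rcons i h a : excess i (rcons h a) = excess i h + phi i h a.
Proof.
rewrite /excess size_rcons big_ord_recr /= nth_rcons ltnn eqxx -cats1.
rewrite take_size_cat //; congr (_ + _); apply: eq_bigr => m _.
by rewrite nth_cat ltn_ord takel_cat // ltnW.
Qed.

Let excess_le i h : `|excess i h| <= (size h)%:R.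
Proof.
apply: (le_trans (ler_norm_sum _ _ _)).
by apply: (le_trans (ler_sum _ (fun m _ => phi_le1 _ _ _)));
  rewrite sumr_const card_ord.
Qed.

Let weight (i : nat) : R := (4 ^+ i)^-1.

Let weight_gt0 i : 0 < weight i.
Proof. by rewrite invr_gt0 exprn_gt0. Qed.

(** The subtracted term is what lets the induction close. *)
Let weight_sum n : \sum_(i < n) weight i <= 2 - 4 / 3 * weight n.
Proof.
elim: n => [|n IHn]; first by rewrite big_ord0 /weight expr0; lra.
rewrite big_ord_recr /=; have -> : weight n.+1 = weight n / 4.
  by rewrite /weight exprS invfM mulrC.
lra.
Qed.

(** Counting only the first [size h] tests keeps the sum finite; each new letter brings in one more
    test. *)
Let potential h := \sum_(i < size h) weight i * excess i h ^+ 2.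

(** Averaging over the letters: the cross terms vanish by [phi_mean0], and the squares of [phi] are
    at most 1. *)
Let letter_choice h : exists a,
  \sum_(i < (size h).+1) weight i * (excess i h + phi i h a) ^+ 2 <=
  \sum_(i < (size h).+1) weight i * (excess i h ^+ 2 + 1).
Proof.
apply: contrapT => /forallNP noa.
pose rhs := \sum_(i < (size h).+1) weight i * (excess i h ^+ 2 + 1).
have : \sum_(a : A) rhs < \sum_(a : A)
    \sum_(i < (size h).+1) weight i * (excess i h + phi i h a) ^+ 2.
  apply: ltr_sum => [|a _]; first by apply/hasP; exists a0; rewrite ?mem_index_enum.
  by rewrite ltNge; apply/negP/noa.
apply/negP; rewrite -leNgt /rhs [leLHS]exchange_big [leRHS]exchange_big /=.
apply: ler_sum => i _; rewrite -!mulr_sumr ler_pM2l //.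
under eq_bigr do rewrite sqrrD.
rewrite !big_split /= -!mulr_sumr phi_mean0 mulr0 !addr0.
rewrite lerD2l ler_sum // => a _.
by rewrite -real_normK ?num_real // expr_le1.
Qed.

Lemma exists_word_sublinear_excess : exists x : word A, forall i e, 0 < e ->
  exists N, forall n, (N <= n)%N ->
    `|\sum_(m < n) phi i (mkseq x m) (x m)| <= e * n%:R.
Proof.
have [next nextP] := choice letter_choice.
pose pre n := iter n (fun h => rcons h (next h)) [::].
pose x n := next (pre n).
have preE n : pre n = mkseq x n.
  elim: n => // n IHn.
  by rewrite mkseqS -IHn.
have size_pre n : size (pre n) = n by rewrite preE size_mkseq.
have excessE i n : excess i (pre n) = \sum_(m < n) phi i (mkseq x m) (x m).
  elim: n => [|n IHn]; first by rewrite /excess !big_ord0.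
  have -> : pre n.+1 = rcons (pre n) (x n) by [].
  by rewrite excess_rcons IHn big_ord_recr /= preE.
(* Each letter adds at most 3: the weights sum to at most 2, and the entering test [n] contributes
   at most 1 because its excess is at most [n], hence at most [2 ^ n]. *)
have pot n : potential (pre n) <= 3 * n%:R.
  elim: n => [|n IHn]; first by rewrite /potential big_ord0 mulr0.
  have := nextP (pre n); rewrite /potential /= size_rcons size_pre.
  under eq_bigr do rewrite -excess_rcons.
  move=> /le_trans; apply.
  under eq_bigr do rewrite mulrDr mulr1.
  rewrite big_split /= big_ord_recr /=.
  have := weight_sum n.+1; have := weight_gt0 n.+1.
  move: IHn; rewrite /potential size_pre.
  have : weight n * excess n (pre n) ^+ 2 <= 1.
    rewrite mulrC ler_pdivrMr ?exprn_gt0 // mul1r.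
    have -> : 4 ^+ n = (2 ^+ n) ^+ 2 :> R.
      by rewrite -exprM mulnC exprM; congr (_ ^+ _); ring.
    rewrite -real_normK ?num_real // lerXn2r ?nnegrE ?exprn_ge0 //.
    apply: (le_trans (excess_le _ _)).
    by rewrite size_pre -natrX ler_nat ltnW // ltn_expl.
  rewrite -[n.+1%:R]natr1; lra.
exists x => i e e0.
(* From here on, [3 * n * 4 ^ i] is at most [(e * n) ^ 2]; the bound [i < n] puts test [i] in the
   potential. *)
pose N := (Num.truncn (3 * 4 ^+ i / e ^+ 2)).+1.
exists (maxn i.+1 N) => n; rewrite geq_max => /andP[ltin leNn].
rewrite -excessE -ler_sqr ?nnegrE ?mulr_ge0 ?(ltW e0) // real_normK ?num_real //.
have n0 : 0 < n%:R :> R by rewrite ltr0n (leq_trans _ ltin).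
have le1 : excess i (pre n) ^+ 2 <= 3 * n%:R * 4 ^+ i.
  rewrite -ler_pdivrMr ?exprn_gt0 // mulrC; apply: le_trans (pot n).
  rewrite /potential size_pre (bigD1 (Ordinal ltin)) //= lerDl.
  by apply: sumr_ge0 => j _; rewrite mulr_ge0 ?sqr_ge0 // ltW.
apply: (le_trans le1).
have : 3 * 4 ^+ i / e ^+ 2 <= n%:R.
  apply: ltW; apply: (lt_le_trans (truncnS_gt _)).
  by rewrite ler_nat.
rewrite ler_pdivrMr ?exprn_gt0 // => h.
rewrite exprMn [n%:R ^+ 2]expr2 mulrA mulrAC ler_pM2r //.
by rewrite [_ ^+ 2 * _]mulrC.
Qed.
End BalancedWord.

(** * Bounds on lower limits *)

Section LimnEinfBounds.
Local Open Scope ereal_scope.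
Variables (R : realType) (u : nat -> \bar R) (v : \bar R).

Lemma limn_einf_le : (forall n, u n <= v) -> limn_einf u <= v.
Proof.
move=> uv; rewrite limn_einf_lim (cvg_lim _ (cvg_einfs_sup (u := u))) //.
apply: ge_ereal_sup => _ [n _ <-]; apply: le_trans (uv n).
by apply: ereal_inf_lbound; exists n => /=.
Qed.

Lemma limn_einf_ge : (forall n, v <= u n) -> v <= limn_einf u.
Proof.
move=> vu; rewrite limn_einf_lim (cvg_lim _ (cvg_einfs_sup (u := u))) //.
apply: le_trans (ereal_sup_ubound _); last by exists 0%N.
by apply: le_ereal_inf_tmp => _ [n _ <-].
Qed.
End LimnEinfBounds.

(** * Compressing the odd subword with the whole word as oracle *)

Section OddSubwordCompressor.
Variables (A : finType) (a0 : A) (L : nat).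
Hypothesis L_gt0 : (0 < L)%N.

(** A period reads [2 * L] oracle letters and [L] input letters and writes one letter, since
    acceptance demands infinite output. It is even, so the state knows the parity of the time. *)
Let period := (2 * L)%N.
Let period_gt0 : (0 < period)%N.
Proof. by rewrite muln_gt0. Qed.

Let next (i : 'I_period) : 'I_period := Ordinal (ltn_pmod i.+1 period_gt0).

Let label (t : nat) (c : A) : 3.-tuple (option A) :=
  [tuple if odd t then Some c else None; Some c;
         if (t %% period == period.-1)%N then Some a0 else None].

(* There is no transition when the input letter differs from the oracle letter, so the automaton
   accepts only the pairs whose input is the odd subword of the oracle. *)
Definition odd_subword_compressor : automaton A 3 :=
  @Automaton A 3 'I_period
    (fun i l j => (j == next i) && [exists c, l == label i c])
    (fun i => val i == 0%N).

Let label_mod t c : label (t %% period) c = label t c.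
Proof. by rewrite /label modn_mod odd_mod // oddM. Qed.

Let cntS (l : nat -> 3.-tuple (option A)) j t :
  cnt l j t.+1 = (cnt l j t + (tnth (l t) j != None))%N.
Proof. by rewrite /cnt -[t.+1]addn1 iotaD count_cat /= addn0. Qed.

Let cnt_label (l : nat -> 3.-tuple (option A)) (x : nat -> A) :
  (forall t, l t = label t (x t)) ->
  forall t, [/\ cnt l c0 t = t./2, cnt l c1 t = t & cnt l c2 t = (t %/ period)%N].
Proof.
move=> lE; elim=> [|t [IH0 IH1 IH2]]; first by rewrite /cnt div0n.
rewrite !cntS IH0 IH1 IH2 lE !(tnth_nth None) /=; split.
- by rewrite uphalf_half addnC; case: (odd t).
- exact: addn1.
rewrite divnS // addnC; congr (_ + _)%N; case: ifP => /eqP E.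
  by rewrite /dvdn -addn1 -modnDml E addn1 prednK // modnn.
apply/esym/eqP; rewrite eqb0; apply/negP; rewrite /dvdn -addn1 -modnDml addn1.
have := ltn_pmod t period_gt0; move: (t %% period)%N E => r E rlt.
by rewrite modn_small //; lia.
Qed.

Let accepting_label q l :
  accepting (M := odd_subword_compressor) q l ->
  exists x, forall t, l t = label t (x t).
Proof.
move=> [q0 [tr _]].
have qE t : val (q t) = (t %% period)%N.
  elim: t => [|t IHt]; first by rewrite mod0n; apply/eqP.
  by have /andP[/eqP -> _] := tr t; rewrite /= IHt -addn1 modnDml addn1.
have lE t : exists c, l t = label t c.
  have /andP[_ /existsP[c /eqP ->]] := tr t.
  by exists c; rewrite qE label_mod.
by have [x xP] := choice lE; exists x.
Qed.

(** At time [2n+1] the run reads input letter [n] and oracle letter [2n+1], and [label] makes them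
    equal. *)
Let accepting_spells q l (y x : word A) :
  accepting (M := odd_subword_compressor) q l ->
  spells l c0 y -> spells l c1 x -> y = fun n => x n.*2.+1.
Proof.
move=> /accepting_label[z lE] sy sx; apply/funext => n.
have [cnt0 cnt1 _] := cnt_label lE n.*2.+1.
have := sy n.*2.+1 (z n.*2.+1); have := sx n.*2.+1 (z n.*2.+1).
rewrite cnt0 cnt1 lE !(tnth_nth None) /= odd_double /= uphalf_double.
by move=> -> // ->.
Qed.

Lemma compressor_odd_subword : compressor odd_subword_compressor.
Proof.
split.
  split; first by exists (Ordinal period_gt0) => q; rewrite -val_eqE.
  move=> p q q' al al' /andP[/eqP -> /existsP[c /eqP ->]].
  move=> /andP[/eqP -> /existsP[c' /eqP ->]]; split.
    move=> [[|[|[]]] //= ltj] _; rewrite !(tnth_nth None) //=.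
    by case: ifP.
  (* The oracle component is never empty, and its letter determines the whole label. *)
  by move=> /(_ c1 isT); rewrite !(tnth_nth None) /= => -[->].
move=> q l q' l' x x' y z acc acc' sx sx' sy sy' _ _.
by rewrite (accepting_spells acc sx sy) (accepting_spells acc' sx' sy').
Qed.

Lemma odd_subword_compressor_ratio (x : word A) : exists2 v,
  compressor_ratio odd_subword_compressor (fun n => x n.*2.+1) x v &
  (v <= (L%:R^-1 : RR)%:E)%E.
Proof.
pose q t : 'I_period := Ordinal (ltn_pmod t period_gt0).
pose l t := label t (x t).
have cl := @cnt_label l x (fun=> erefl).
have lt_per N : (N <= N * period + period.-1)%N.
  by rewrite -[X in (X <= _)%N]addn0 leq_add // leq_pmulr.
eexists; first exists q, l; first split.
- split; first by rewrite unfold_in /= mod0n.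
  split=> [t|j N].
    apply/andP; split; last by apply/existsP; exists (x t); rewrite /= label_mod.
    by rewrite -val_eqE /= -addn1 -[in X in _ == X]addn1 modnDml.
  (* The last step of a period has odd index, so all three components are nonempty there. *)
  exists (N * period + period.-1)%N; split => //.
  rewrite /l (tnth_nth None) /=; case: j => [[|[|[]]] //= _].
    have -> // : odd (N * period + period.-1).
    by rewrite oddD oddM /period oddM andbF -subn1 oddB ?muln_gt0 // oddM.
  by rewrite modnMDl modn_small ?eqxx // prednK.
- move=> t a; have [-> _ _] := cl t.
  rewrite (tnth_nth None) /=; case: ifP => // ot [<-].
  by congr (x _); rewrite -[RHS]odd_double_half ot.
- move=> t a; have [_ -> _] := cl t.
  by rewrite (tnth_nth None) /= => -[].
- reflexivity.
apply: limn_einf_le => n; rewrite lee_fin.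
have [-> _ ->] := cl n.+1.
(* After a single step no input letter has been read, and the quotient by 0 is 0. *)
have [h0|h0] := posnP n.+1./2; first by rewrite h0 invr0 mulr0 invr_ge0.
rewrite ler_pdivrMr ?ltr0n // mulrC ler_pdivlMr ?ltr0n // -natrM ler_nat.
by rewrite -divn2 /period divnMA leq_trunc_div.
Qed.
End OddSubwordCompressor.

Lemma rho_cond_ge0 (A : finType) (x y : word A) : (0 <= rho_cond x y)%E.
Proof.
apply: le_ereal_inf_tmp => _ [C [_ [q [l [_ _ _ ->]]]]].
by apply: limn_einf_ge => n; rewrite lee_fin divr_ge0.
Qed.

Lemma rho_cond_odd_subword (A : finType) (a0 : A) (x : word A) :
  rho_cond (fun n => x n.*2.+1) x = 0%E.
Proof.
apply/eqP; rewrite eq_le rho_cond_ge0 andbT; apply/lee_addgt0Pr => e e0.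
rewrite add0e; pose L := (Num.truncn e^-1).+1.
have [v xv vL] := odd_subword_compressor_ratio a0 (ltn0Sn _ : 0 < L)%N x.
apply: (@le_trans _ _ v).
  apply: ereal_inf_lbound; exists (odd_subword_compressor a0 (ltn0Sn _ : 0 < L)%N).
  by split=> //; apply: compressor_odd_subword.
apply: (le_trans vL); rewrite lee_fin invf_ple ?posrE ?ltr0n //.
exact/ltW/truncnS_gt.
Qed.

(** * Densities of index sets and their link with normality *)

Section Density.
Variable R : realType.
Implicit Types (c : nat -> bool) (p : R).

Definition freq c n : R := (count c (iota 0 n))%:R.

(** Without a quotient, errors add up linearly and [n = 0] is harmless. *)
Definition density c p := forall e : R, 0 < e ->
  exists N, forall n, (N <= n)%N -> `|freq c n - p * n%:R| <= e * n%:R.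

Lemma freq0 c : freq c 0 = 0.
Proof. by []. Qed.

Lemma freqS c n : freq c n.+1 = freq c n + (c n)%:R.
Proof. by rewrite /freq -[n.+1]addn1 iotaD count_cat natrD /= addn0. Qed.

Lemma eq_density c c' p : c =1 c' -> density c p -> density c' p.
Proof. by move=> /funext ->. Qed.

(** Serves to discard block 0 of the join, whose letters may come from repeated positions of the
    word. One index changes the error by at most [1 + |p|]. *)
Lemma density_shift c p : density (fun n => c n.+1) p -> density c p.
Proof.
move=> dc e e0; have [N NP] := dc (e / 2) (divr_gt0 e0 (ltr0n _ 2)).
pose M := (Num.truncn ((1 + `|p|) / (e / 2))).+1.
exists (maxn N M).+1 => -[//|n]; rewrite ltnS geq_max => /andP[/NP + Mn].
have -> : freq c n.+1 = freq (fun n => c n.+1) n + (c 0%N)%:R.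
  elim: n {Mn} => [|n IHn]; first by rewrite freqS !freq0.
  by rewrite freqS IHn freqS addrAC.
have : (1 + `|p|) <= n%:R * (e / 2).
  rewrite -ler_pdivrMr ?divr_gt0 //; apply: ltW.
  by apply: (lt_le_trans (truncnS_gt _)); rewrite ler_nat.
have : `|(c 0%N)%:R : R| <= 1 by case: (c _); rewrite ?normr1 ?normr0.
rewrite -[n.+1%:R]natr1 !ler_norml => /andP[? ?].
have : - `|p| <= p <= `|p| by rewrite -ler_norml.
by move=> /andP[? ?] ? /andP[? ?]; apply/andP; split; lra.
Qed.

(** Blocks of length [l] with even and odd index are the first and second halves of blocks of length
    [2 * l], which are the ones controlled later. *)
Lemma density_parity c p : density (fun n => c n.*2) p ->
  density (fun n => c n.*2.+1) p -> density c p.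
Proof.
move=> d0 d1 e e0.
have [N0 NP0] := d0 (e / 2) (divr_gt0 e0 (ltr0n _ 2)).
have [N1 NP1] := d1 (e / 2) (divr_gt0 e0 (ltr0n _ 2)).
pose M := (Num.truncn ((1 + `|p|) / (e / 2))).+1.
exists (maxn (maxn N0 N1).*2 M).+1 => n ltn.
have fE k : freq c k.*2 = freq (fun n => c n.*2) k + freq (fun n => c n.*2.+1) k.
  elim: k => [|k IHk]; first by rewrite !freq0 addr0.
  by rewrite doubleS !freqS IHk; ring.
have := NP0 n./2; have := NP1 n./2.
move/(_ ltac:(lia)) => h1 /(_ ltac:(lia)) h0.
have nE : n%:R = n./2%:R + n./2%:R + (odd n)%:R :> R.
  by rewrite -!natrD addnn addnC odd_double_half.
have -> : freq c n = freq c n./2.*2 + (odd n && c n.-1)%:R.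
  rewrite -[in LHS](odd_double_half n); case: (boolP (odd n)) => on /=.
    by rewrite add1n freqS; congr (_ + (c _)%:R); lia.
  by rewrite add0n addr0.
rewrite fE.
have : (1 + `|p|) <= n%:R * (e / 2).
  rewrite -ler_pdivrMr ?divr_gt0 //; apply: ltW.
  apply: (lt_le_trans (truncnS_gt _)); rewrite ler_nat.
  exact: leq_trans (leq_maxr _ _) (ltnW ltn).
have /andP[? ?] : - `|p| <= p <= `|p| by rewrite -ler_norml.
have /andP[? ?] : - `|p| <= (odd n && c n.-1)%:R - p * (odd n)%:R <= 1 + `|p|.
  by case: (odd n); case: (c _) => /=; rewrite ?(mulr1, mulr0);
    apply/andP; split; lra.
move: h0 h1; rewrite nE !ler_norml => /andP[? ?] /andP[? ?] ?.
have : 0 <= e * (odd n)%:R by rewrite mulr_ge0 // ltW.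
by move=> ?; apply/andP; split; lra.
Qed.
End Density.

(** Only [n %/ l] complete blocks are counted while normality divides by the exact [n / l]; after
    multiplication by [l] the discrepancy is at most [|p| * l], negligible against [n]. *)
Lemma normal_density (A : finType) (x : word A) :
  (forall l (u : seq A), (0 < l)%N -> size u = l ->
    density (fun j => mkseq (fun i => x (j * l + i)%N) l == u)
      ((#|A|%:R : RR) ^- l)) -> normal x.
Proof.
move=> dx l l0 u ul; apply/(@cvgrPdist_le RR RR^o) => e e0.
have [N NP] := dx l u l0 ul (e / 2) (divr_gt0 e0 (ltr0n _ 2)).
set p := _ ^- l in NP *.
have lp : 0 < l%:R :> RR by rewrite ltr0n.
pose M := (Num.truncn (`|p| * l%:R / (e / 2))).+1.
exists (N * l + M)%N => // n /= len.
have n0 : 0 < n%:R :> RR by rewrite ltr0n; lia.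
have : (N <= n %/ l)%N by rewrite leq_divRL //; lia.
move=> /NP; rewrite /freq -/(aligned_occ x l u n).
have : `|p| * l%:R <= n%:R * (e / 2).
  rewrite -ler_pdivrMr ?divr_gt0 //; apply: ltW.
  apply: (lt_le_trans (truncnS_gt _)); rewrite ler_nat.
  exact: leq_trans (leq_addl _ _) len.
move=> hM h.
rewrite distrC invf_div mulrA -(ler_pM2r n0) -[X in _ * X <= _](gtr0_norm n0).
rewrite -normrM mulrBl divfK ?gt_eqF //.
have nE : n%:R = (n %/ l)%:R * l%:R + (n %% l)%:R :> RR.
  by rewrite -natrM -natrD -divn_eq.
have -> : (aligned_occ x l u n)%:R * l%:R - p * n%:R =
    ((aligned_occ x l u n)%:R - p * (n %/ l)%:R) * l%:R - p * (n %% l)%:R :> RR.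
  by rewrite nE; ring.
have rl : (n %% l)%:R <= l%:R :> RR by rewrite ler_nat ltnW // ltn_pmod.
apply: (le_trans (ler_normB _ _)); rewrite !normrM !normr_nat.
have h1 := ler_pM (normr_ge0 _) (ltW lp) h (lexx _).
have h2 := ler_pM (normr_ge0 p) (ler0n _ _) (lexx _) rl.
apply: (le_trans (lerD h1 h2)).
have h3 : e / 2 * ((n %/ l)%:R * l%:R) <= e / 2 * n%:R.
  by rewrite ler_pM2l ?divr_gt0 // nE lerDl.
by move: h3 hM; lra.
Qed.

(** * Equidistribution of patterns along increasing families of positions *)

Section EquidistributedPatterns.
Variables (R : realType) (A : finType) (a0 : A).

Let card_ge1 : 1 <= #|A|%:R :> R.
Proof. by rewrite ler1n; apply/card_gt0P; exists a0. Qed.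

Let card_gt0 : 0 < #|A|%:R :> R.
Proof. exact: lt_le_trans ltr01 card_ge1. Qed.

Lemma exists_balanced_word (I : countType) (E : I -> seq A -> bool)
    (a : I -> A) :
  exists x : word A, forall i e, 0 < e -> exists N, forall n, (N <= n)%N ->
    `|\sum_(m < n) (E i (mkseq x m))%:R * ((x m == a i)%:R - #|A|%:R^-1)|
      <= e * n%:R :> R.
Proof.
pose phi k h c : R := if unpickle k is Some i
  then (E i h)%:R * ((c == a i)%:R - #|A|%:R^-1) else 0.
have [|k h c|x xP] := @exists_word_sublinear_excess R A a0 phi.
- move=> k h; rewrite /phi; case: unpickle => [i|]; last by rewrite big1.
  rewrite -mulr_sumr big_split /= sumr_const -[X in _ + X]mulr_natl mulrN.
  rewrite mulfV ?gt_eqF // (bigD1 (a i)) //= eqxx big1 ?addr0 ?subrr ?mulr0 //.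
  by move=> c /negPf ->.
- rewrite /phi; case: unpickle => [i|]; last by rewrite normr0.
  have /andP[? ?] : 0 < (#|A|%:R^-1 : R) <= 1 by rewrite invr_gt0 card_gt0 invf_le1.
  case: (E i h); rewrite ?mul0r ?normr0 // mul1r ler_norml.
  by case: (c == _) => /=; apply/andP; split; lra.
exists x => i e /(xP (pickle i)) [N NP]; exists N => n /NP.
by rewrite /phi pickleK.
Qed.

(* A [None] in the pattern matches every letter. *)
Definition fits (w : nat -> A) (p : seq (option A)) :=
  all (fun k => if nth None p k is Some a then w k == a else true)
    (iota 0 (size p)).

Lemma fits_rcons w p o : fits w (rcons p o) =
  fits w p && (if o is Some a then w (size p) == a else true).
Proof.
rewrite /fits size_rcons -addn1 iotaD all_cat /= andbT nth_rcons ltnn eqxx.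
congr (_ && _); apply: eq_in_all => k; rewrite mem_iota /= => kp.
by rewrite nth_rcons kp.
Qed.

Lemma eq_fits w w' p : (forall k, (k < size p)%N -> w k = w' k) ->
  fits w p = fits w' p.
Proof.
by move=> ww'; apply: eq_in_all => k; rewrite mem_iota => /ww' ->.
Qed.

(** Passes from positions in the word to block indices. As [s] is increasing, [j <= s j], so the
    search may stop at [m], and at most one [j] is found. *)
Lemma sum_reindex_increasing (s : nat -> nat) (Q : nat -> bool) (F : nat -> R) n :
  {homo s : i j / (i < j)%N} ->
  \sum_(m < s n) (has (fun j => (s j == m) && Q j) (iota 0 m.+1))%:R * F m
  = \sum_(j < n) (Q j)%:R * F (s j).
Proof.
move=> s_incr; have s_mono := leqW_mono (leq_mono s_incr).
have s_ge j : (j <= s j)%N.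
  by elim: j => // j IHj; apply: leq_ltn_trans IHj (s_incr _ _ _).
pose G m := (has (fun j => (s j == m) && Q j) (iota 0 m.+1))%:R * F m.
have G0 m : (forall j, s j <> m) -> G m = 0.
  move=> sm; suff /negPf Gm : ~~ has (fun j => (s j == m) && Q j) (iota 0 m.+1).
    by rewrite /G Gm mul0r.
  by apply/hasPn => j _; have /eqP/negPf -> := sm j.
have Gs k : G (s k) = (Q k)%:R * F (s k).
  rewrite /G; congr (_ %:R * _); congr nat_of_bool.
  apply/hasP/idP => [[j _ /andP[/eqP]]|Qk].
    by move=> /(inc_inj (leq_mono s_incr)) ->.
  by exists k; rewrite ?eqxx // mem_iota /= add0n ltnS.
rewrite -(big_mkord xpredT G); elim: n => [|n IHn].
  rewrite big_ord0 big_nat big1 // => m m0.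
  by apply: G0 => j jm; move: m0; rewrite -jm s_mono.
(* Between [s n] included and [s n.+1] excluded, only [s n] is a value of [s]. *)
rewrite (big_cat_nat (n := s n)) //=; last exact/ltnW/s_incr.
rewrite IHn big_ord_recr big_ltn ?s_incr //= Gs.
rewrite [X in _ + (_ + X)]big_nat [X in _ + (_ + X)]big1 ?addr0 //.
move=> m /andP[lo hi]; apply: G0 => j jm.
by move: lo hi; rewrite -jm !s_mono ltnS => /leq_trans le /le; rewrite ltnn.
Qed.

(** Induction on the pattern from its end. The test for [p] followed by [a] predicts [a] whenever
    [p] has just been matched, so a small excess divides the density by [#|A|]. Growth in [k] puts
    the earlier letters in the history, growth in [j] makes the position determine the block, and
    linear growth turns an error small against the position into one small against the number of
    blocks. *)
Lemma exists_equidistributed_word (I : countType) (s : I -> nat -> nat -> nat) :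
  (forall i j, {homo s i j : k k' / (k < k')%N}) ->
  (forall i k, {homo (s i)^~ k : j j' / (j < j')%N}) ->
  (forall i k, exists C, forall j, (s i j k <= C * j.+1)%N) ->
  exists x : word A, forall i p,
    density (fun j => fits (fun k => x (s i j k)) p) (#|A|%:R ^- count isSome p : R).
Proof.
move=> s_incrk s_incrj s_lin.
pose E (t : I * seq (option A) * A) (h : seq A) :=
  let: (i, p, _) := t in
  has (fun j => (s i j (size p) == size h) && fits (fun k => nth a0 h (s i j k)) p)
    (iota 0 (size h).+1).
have [x xP] := exists_balanced_word E (fun t => t.2).
exists x => i p; elim/last_ind: p => [|p [a|] IHp].
- move=> e e0; exists 0%N => n _; rewrite /= expr0 invr1 mul1r.
  suff -> : freq R (fun=> true) n = n%:R.
    by rewrite subrr normr0 mulr_ge0 // ltW.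
  by elim: n => [|n IHn]; rewrite ?freq0 // freqS IHn natr1.
- set c := (fun j => fits _ p) in IHp.
  set q := _ ^- _ in IHp.
  have -> : #|A|%:R ^- count isSome (rcons p (Some a)) = q / #|A|%:R.
    by rewrite -cats1 count_cat /= addn1 exprS invfM mulrC.
  have [C CP] := s_lin i (size p).
  move=> e e0; have e1 : 0 < e / 2 by rewrite divr_gt0.
  (* As [n > 0], the position is at most [C * n.+1], hence at most [C.+1 * (2 * n)]; this tolerance
     then yields an error of [e / 2 * n]. *)
  have e2 : 0 < e / (4 * C.+1%:R) by rewrite divr_gt0 ?mulr_gt0.
  have [N NP] := IHp _ e1; have [M MP] := xP (i, p, a) _ e2.
  exists (maxn N M).+1 => n; rewrite gtn_max => /andP[Nn Mn].
  have s_ge : (n <= s i n (size p))%N.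
    by elim: n {Nn Mn} => // n IHn; apply: leq_ltn_trans IHn (s_incrj _ _ _ _ _).
  have := MP _ (leq_trans (ltnW Mn) s_ge).
  have EE m : E (i, p, a) (mkseq x m) =
      has (fun j => (s i j (size p) == m) && c j) (iota 0 m.+1).
    rewrite /E size_mkseq; apply: eq_in_has => j _; case: eqP => //= <-.
    by apply: eq_fits => k kp; rewrite nth_mkseq // s_incrk.
  under eq_bigr do rewrite EE.
  rewrite (sum_reindex_increasing c (fun m => (x m == a)%:R - #|A|%:R^-1));
    last exact: s_incrj.
  have -> : \sum_(j < n) (c j)%:R * ((x (s i j (size p)) == a)%:R - #|A|%:R^-1)
      = freq R (fun j => fits (fun k => x (s i j k)) (rcons p (Some a))) n
        - freq R c n / #|A|%:R.
    elim: n {Nn Mn s_ge} => [|n IHn]; first by rewrite big_ord0 !freq0 mul0r subrr.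
    rewrite big_ord_recr /= IHn !freqS fits_rcons -/(c n).
    by case: (c n); case: (x _ == a) => /=; ring.
  move: (NP _ (ltnW Nn)) => h1 h2.
  have h3 : e / (4 * C.+1%:R) * (s i n (size p))%:R <= e / 2 * n%:R.
    have -> : e / 2 * n%:R = e / (4 * C.+1%:R) * (C.+1 * n.*2)%:R.
      by rewrite natrM -addnn natrD; field; rewrite gt_eqF ?ltr0n.
    rewrite ler_pM2l // ler_nat (leq_trans (CP n)) //.
    by rewrite leq_mul // -addnn -addn1 leq_add2l; lia.
  have h4 : `|(freq R c n - q * n%:R) / #|A|%:R| <= e / 2 * n%:R.
    rewrite normrM; apply: le_trans h1.
    by rewrite ler_piMr // ger0_norm ?invf_le1 // invr_ge0 ltW.
  have := lerD (le_trans h2 h3) h4; rewrite -mulrDl -splitr.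
  by move/(le_trans (ler_normD _ _)); congr (`|_| <= _); ring.
- have -> : count isSome (rcons p None) = count isSome p.
    by rewrite -cats1 count_cat addn0.
  by apply: eq_density IHp => j; rewrite fits_rcons andbT.
Qed.
End EquidistributedPatterns.

(** * Blocks of the join as patterns at increasing positions *)

(* Positions in x of the letters of the j-th block of length 2l of the join of x and its odd
   subword; the letters at even positions of the join (k < l) come first, because then the
   positions in x increase with k as soon as j > 0. *)
Definition source (l j k : nat) : nat :=
  if (k < l)%N then (l * j + k)%N else (2 * (l * j) + 2 * (k - l) + 1)%N.

Lemma source_incr_letter l j : (0 < j)%N ->
  {homo source l j : k k' / (k < k')%N}.
Proof.
move=> j0 k k' kk'; rewrite /source; have := leq_pmulr l j0.
by case: (ltnP k l); case: (ltnP k' l); lia.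
Qed.

Lemma source_incr_block l k : (0 < l)%N ->
  {homo (source l)^~ k : j j' / (j < j')%N}.
Proof.
move=> l0 j j' jj'; rewrite /source; have : (l * j < l * j')%N by rewrite ltn_pmul2l.
by case: (ltnP k l); lia.
Qed.

Lemma source_le l j k : (source l j.+1 k <= (2 * l + 2 * k + 1) * j.+1)%N.
Proof. by rewrite /source; case: (ltnP k l); nia. Qed.

(** Entry [k] is the offset, inside a block of the join, of the letter taken from position
    [source l j k]. *)
Definition join_order (l : nat) : seq nat :=
  [seq (2 * k)%N | k <- iota 0 l] ++ [seq (2 * k + 1)%N | k <- iota 0 l].

Lemma perm_join_order l : perm_eq (join_order l) (iota 0 (2 * l)).
Proof.
apply: uniq_perm; rewrite ?iota_uniq //.
  rewrite cat_uniq !map_inj_uniq ?iota_uniq /= ?andbT; try by move=> ? ?; lia.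
  by apply/hasPn => _ /mapP[k _ ->]; apply/negP => /mapP[k' _]; lia.
move=> t; rewrite mem_cat mem_iota; apply/orP/idP.
  by case=> /mapP[k]; rewrite mem_iota => kl ->; lia.
move=> tl; have := odd_double_half t; case: (odd t) => /= tE; [right|left];
  by apply/mapP; exists t./2; rewrite ?mem_iota; lia.
Qed.

(** Constrains one part of a block of length [2 * l] and leaves the rest free. *)
Definition padded (A : Type) (m : nat) (u : seq A) (n : nat) : seq (option A) :=
  nseq m None ++ map some u ++ nseq n None.

Lemma size_padded (A : Type) m (u : seq A) n :
  size (padded m u n) = (m + size u + n)%N.
Proof. by rewrite !size_cat !size_nseq size_map addnA. Qed.

Lemma count_padded (A : Type) m (u : seq A) n :
  count isSome (padded m u n) = size u.
Proof.
by rewrite !count_cat !count_nseq count_map !mul0n add0n addn0 count_predT.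
Qed.

Lemma nth_padded (A : Type) (a0 : A) m (u : seq A) n k :
  nth None (padded m u n) k =
  if (m <= k < m + size u)%N then Some (nth a0 u (k - m)) else None.
Proof.
rewrite /padded !nth_cat size_nseq size_map !nth_nseq.
case: (ltnP k m) => [//|mk]; rewrite -(ltn_subLR (size u) mk) andTb.
case: ifP => ku; first by rewrite (nth_map a0).
by rewrite if_same.
Qed.

Lemma fits_padded (A : finType) (w : nat -> A) m (u : seq A) n :
  fits w (padded m u n) = (mkseq (fun i => w (m + i)%N) (size u) == u).
Proof.
apply/allP/eqP => [wu|uE k _].
  apply: (@eq_from_nth _ (w 0%N)); rewrite size_mkseq // => i iu.
  have := wu (m + i)%N; rewrite mem_iota size_padded nth_mkseq // (nth_padded (w 0%N)).
  rewrite leq_addr ltn_add2l iu addKn /= => /(_ _)/eqP -> //; lia.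
rewrite (nth_padded (w 0%N)); case: ifP => // /andP[mk ku].
by rewrite -uE nth_mkseq ?subnKC //; lia.
Qed.

(** * Normality of the word, its odd subword and their join *)

Section NormalWords.
Variables (A : finType) (x : word A).
Hypothesis density_fits : forall l p, (0 < l)%N ->
  density (fun j => fits (x \o source l j) p) (#|A|%:R ^- count isSome p : RR).

Let z : word A := join x (fun n => x n.*2.+1).

Lemma join_source l j k : (k < 2 * l)%N ->
  x (source l j k) = z (2 * (l * j) + nth 0 (join_order l) k)%N.
Proof.
move=> kl; rewrite /z /join /source /join_order nth_cat size_map size_iota.
case: ltnP => lk; rewrite (nth_map 0%N) ?size_iota ?nth_iota //; try lia.
  have -> : (2 * (l * j) + 2 * (0 + k) = (l * j + k).*2)%N by rewrite -mul2n; lia.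
  by rewrite odd_double doubleK.
have -> : (2 * (l * j) + (2 * (0 + (k - l)) + 1) = (l * j + (k - l)).*2.+1)%N.
  by rewrite -mul2n; lia.
rewrite /= odd_double /= uphalf_double; congr (x _).
by rewrite -mul2n; lia.
Qed.

(** Permuting the padded pattern by [join_order] turns a condition on the join into one along
    [source]; neither the number of constrained letters nor the conjunction of constraints depends
    on the order. *)
Lemma density_join_block l m (u : seq A) n : (0 < l)%N ->
  (m + size u + n = 2 * l)%N ->
  density (fun j => mkseq (fun i => z (2 * (l * j) + (m + i))%N) (size u) == u)
    (#|A|%:R ^- size u : RR).
Proof.
move=> l0 mun; set v := padded m u n.
have vl : size v = (2 * l)%N by rewrite size_padded.
have szT : size (join_order l) = (2 * l)%N.
  by rewrite (perm_size (perm_join_order l)) size_iota.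
have := @density_fits l [seq nth None v t | t <- join_order l] l0.
have -> : count isSome [seq nth None v t | t <- join_order l] = size u.
  rewrite -(count_padded m u n) -/v -[in RHS](mkseq_nth None v) vl.
  by apply/permP/perm_map/perm_join_order.
apply: eq_density => j.
rewrite -(fits_padded (fun t => z (2 * (l * j) + t)%N) m u n) -/v.
rewrite {2}/fits vl -(perm_all _ (perm_join_order l)).
rewrite -[in RHS](mkseq_nth 0%N (join_order l)).
rewrite /mkseq all_map /fits size_map szT; apply: eq_in_all => k.
rewrite mem_iota add0n /= => kl; rewrite (nth_map 0%N) ?szT //.
by rewrite join_source.
Qed.

Lemma normal_join : normal z.
Proof.
apply: normal_density => l u l0 ul; apply: density_parity.
  have := @density_join_block l 0 u l l0; rewrite ul add0n mul2n addnn => /(_ erefl).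
  apply: eq_density => j; congr (_ == _); apply: eq_mkseq => i; congr (z _).
  by rewrite -!mul2n; lia.
have := @density_join_block l l u 0 l0; rewrite ul addn0 mul2n addnn => /(_ erefl).
apply: eq_density => j; congr (_ == _); apply: eq_mkseq => i; congr (z _).
by rewrite -!mul2n; lia.
Qed.

(** The first [l] positions of [source l j] are those of block [j] of [x]. *)
Lemma normal_word : normal x.
Proof.
apply: normal_density => l u l0 ul.
have := @density_fits l (padded 0 u 0) l0; rewrite count_padded ul.
apply: eq_density => j; rewrite fits_padded ul; congr (_ == u).
apply: (@eq_from_nth _ (x 0%N)); rewrite !size_mkseq // => i il.
by rewrite !nth_mkseq //= /source il mulnC.
Qed.

(** The last [l] positions of [source l j] carry block [j] of the odd subword. *)
Lemma normal_odd_subword : normal (fun n => x n.*2.+1).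
Proof.
apply: normal_density => l u l0 ul.
have := @density_fits l (padded l u 0) l0; rewrite count_padded ul.
apply: eq_density => j; rewrite fits_padded ul; congr (_ == u).
apply: eq_mkseq => i; rewrite /= /source ltnNge leq_addr /=; congr (x _).
by rewrite -mul2n; lia.
Qed.
End NormalWords.

Lemma exists_normal_join (A : finType) (a0 : A) : exists x : word A,
  [/\ normal x, normal (fun n => x n.*2.+1) & normal (join x (fun n => x n.*2.+1))].
Proof.
(* The successors provide the positivity of [l] and [j] that the monotonicity of [source]
   requires. *)
have [|||x xP] := @exists_equidistributed_word RR A a0 nat
    (fun l j => source l.+1 j.+1).
- by move=> l j; apply: source_incr_letter.
- by move=> l k j j' jj'; apply: source_incr_block.
- by move=> l k; exists (2 * l.+1 + 2 * k + 1)%N => j; apply: source_le.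
have dx l p : (0 < l)%N ->
    density (fun j => fits (x \o source l j) p) (#|A|%:R ^- count isSome p : RR).
  by case: l => // l _; apply: density_shift; apply: xP.
by exists x; split; [apply: normal_word|apply: normal_odd_subword|apply: normal_join].
Qed.

Theorem theorem8 (A : finType) (hA : (2 <= #|A|)%N) :
  exists x y : word A,
    [/\ normal x, normal y, normal (join x y) & ~ fs_independent x y].
Proof.
have /card_gt0P[a0 _] : (0 < #|A|)%N by apply: leq_trans hA.
have [x [nx ny nxy]] := exists_normal_join a0.
exists x, (fun n => x n.*2.+1); split=> // -[_ rho_yx _ rho_y].
by apply: rho_y; rewrite -rho_yx rho_cond_odd_subword.
Qed.
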